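(* Let $\mathcal{V}$ be a braided monoidal closed category with equalizers of coreflexive pairs, let $A$ and $B$ be monoids in $\mathcal{V}$ such that the universal measuring comonoid $P(A,B)$ exists, let $f\colon A\to B$ be a monoid morphism and let $\bar f\colon I\to P(A,B)$ be the comonoid morphism corresponding to $f$. If the universal measuring comodule $Q(M,N)$ exists for a pair of modules $M_A$ and $N_B$, then the object of coinvariants $\bar f^*Q(M,N)$ is isomorphic to the $\mathcal{V}$-enriched internal hom from $M$ to $f^*N$ of the $\mathcal{V}$-category $\mathsf{Mod}_A$.
   Context: Let $(\mathcal{V},\otimes,I)$ be braided monoidal closed, with $[X,-]$ right adjoint to $-\otimes X$. $\mathsf{Mod}(\mathcal{V})$ (global category of modules) has objects $M_A$, with $A$ a monoid and $M$ a right $A$-module with action $\mu$; a morphism $M_A\to N_B$ is a pair $(p,f)$ with $f\colon A\to B$ a monoid morphism and $p\colon M\to N$ with $p\circ\mu=\mu\circ(p\otimes f)$. $\mathsf{Mod}_A$ is the category of right $A$-modules, and $f^*\colon\mathsf{Mod}_B\to\mathsf{Mod}_A$ is restriction of scalars. $\mathsf{Comod}(\mathcal{V})$ (global category of comodules) has objects $X_C$, with $C$ a comonoid and $X$ a right $C$-comodule with coaction $\chi$; a morphism $X_C\to Y_D$ is a pair $(k,g)$ with $g\colon C\to D$ a comonoid morphism and $k\colon X\to Y$ with $\chi\circ k=(k\otimes g)\circ\chi$. $\mathsf{Comod}_C$ is the category of right $C$-comodules, and a comonoid morphism $u\colon C\to D$ induces corestriction $u_!\colon\mathsf{Comod}_C\to\mathsf{Comod}_D$.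 For a comonoid $C$ and monoid $B$, $[C,B]$ is a monoid under convolution: its multiplication is the transpose of $[C,B]\otimes[C,B]\otimes C\to[C,B]\otimes[C,B]\otimes C\otimes C\cong[C,B]\otimes C\otimes[C,B]\otimes C\to B\otimes B\to B$ (comultiplication, braiding $c_{[C,B],C}$, evaluations, multiplication). For $X_C$, $N_B$, $[X,N]$ is a $[C,B]$-module with action the transpose of $[X,N]\otimes[C,B]\otimes X\to[X,N]\otimes[C,B]\otimes X\otimes C\cong[X,N]\otimes X\otimes[C,B]\otimes C\to N\otimes B\to N$ (coaction, braiding $c_{[C,B],X}$, evaluations, action). $P(A,B)$ is defined by $\mathsf{Comon}(\mathcal{V})(C,P(A,B))\cong\mathsf{Mon}(\mathcal{V})(A,[C,B])$ naturally in $C$; taking $C=I$, a monoid morphism $f\colon A\to B\cong[I,B]$ corresponds to $\bar f\colon I\to P(A,B)$. $Q(M,N)$ is the object of $\mathsf{Comod}(\mathcal{V})$ defined by $\mathsf{Comod}(\mathcal{V})(X,Q(M,N))\cong\mathsf{Mod}(\mathcal{V})(M,[X,N])$ naturally in $X$. It is taken with underlying comonoid $P(A,B)$, the comonoid component of the universal module measuring being the universal measuring; i.e. for $X=X_C$ the bijection $\mathsf{Comod}(\mathcal{V})(X,Q(M,N))\cong\mathsf{Mod}(\mathcal{V})(M,[X,N])$ lies over $\mathsf{Comon}(\mathcal{V})(C,P(A,B))\cong\mathsf{Mon}(\mathcal{V})(A,[C,B])$. For a comonoid morphism $u\colon I\to C$ and $X\in\mathsf{Comod}_C$, the object of coinvariants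 $u^*X\in\mathcal{V}$ represents the functor $\mathsf{Comod}_C(u_!(-),X)\colon\mathcal{V}^{\mathrm{op}}\cong\mathsf{Comod}_I^{\mathrm{op}}\to\mathsf{Set}$; it is the equalizer of the coaction $X\to X\otimes C$ and $1_X\otimes u$. The $\mathcal{V}$-enriched hom of $\mathsf{Mod}_A$ from $M$ to $L$ is, up to isomorphism, the representing object of $\mathsf{Mod}_A(M,[-,L])\colon\mathcal{V}^{\mathrm{op}}\to\mathsf{Set}$, where $[Z,L]$ has the $A$-module structure induced by that of $L$, namely the action that is the transpose of $[Z,L]\otimes A\otimes Z\cong[Z,L]\otimes Z\otimes A\to L\otimes A\to L$ (braiding $c_{A,Z}$, evaluation, action of $L$); equivalently, the $[I,A]$-module structure on $[Z,L]$ for $Z$ regarded as the trivial $I$-comodule, transported along $[I,A]\cong A$. *)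

(* Defs.v *)
From mathcomp Require Import ssreflect ssrfun.
From Stdlib Require Import ProofIrrelevance.

Set Implicit Arguments.
Unset Strict Implicit.
Unset Printing Implicit Defensive.

Declare Scope cat_scope.
Delimit Scope cat_scope with cat.
Local Open Scope cat_scope.

Reserved Notation "g ∘ f" (at level 40, left associativity).
Reserved Notation "X ⊗ Y" (at level 38, left associativity).
Reserved Notation "X ~> Y" (at level 70, no associativity).

Record category := Category {
  Ob :> Type;
  Hom : Ob -> Ob -> Type;
  idm : forall X, Hom X X;
  comp : forall X Y Z, Hom Y Z -> Hom X Y -> Hom X Z;
  comp1f : forall X Y (f : Hom X Y), comp (idm Y) f = f;
  compf1 : forall X Y (f : Hom X Y), comp f (idm X) = f;
  compA : forall W X Y Z (h : Hom Y Z) (g : Hom X Y) (f : Hom W X),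
    comp h (comp g f) = comp (comp h g) f }.
Arguments Hom {_} _ _.
Arguments idm {_ _}.
Arguments comp {_ _ _ _} _ _.
Notation "X ~> Y" := (Hom X Y) : cat_scope.
Notation "g ∘ f" := (comp g f) : cat_scope.
Notation "'id_' X" := (@idm _ X) (at level 9, X at level 9) : cat_scope.

Record iso (C : category) (X Y : C) := Iso {
  iso_hom :> X ~> Y;
  iso_inv : Y ~> X;
  iso_homK : iso_inv ∘ iso_hom = idm;
  iso_invK : iso_hom ∘ iso_inv = idm }.
Arguments iso_inv {_ _ _} _.

Record monoidal := Monoidal {
  mon_cat :> category;
  tens : mon_cat -> mon_cat -> mon_cat;
  tensm : forall W X Y Z : mon_cat,
    W ~> Y -> X ~> Z -> tens W X ~> tens Y Z;
  unit_ob : mon_cat;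
  assoc : forall X Y Z : mon_cat,
    iso (tens (tens X Y) Z) (tens X (tens Y Z));
  lunit : forall X : mon_cat, iso (tens unit_ob X) X;
  runit : forall X : mon_cat, iso (tens X unit_ob) X;
  tensm1 : forall X Y : mon_cat, tensm (id_ X) (id_ Y) = idm;
  tensmM : forall X X' X'' Y Y' Y'' (f' : X' ~> X'') (f : X ~> X')
      (g' : Y' ~> Y'') (g : Y ~> Y'),
    tensm (f' ∘ f) (g' ∘ g) = tensm f' g' ∘ tensm f g;
  assoc_nat : forall X X' Y Y' Z Z' (f : X ~> X') (g : Y ~> Y') (h : Z ~> Z'),
    assoc X' Y' Z' ∘ tensm (tensm f g) h
      = tensm f (tensm g h) ∘ assoc X Y Z;
  lunit_nat : forall X X' (f : X ~> X'),
    lunit X' ∘ tensm idm f = f ∘ lunit X;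
  runit_nat : forall X X' (f : X ~> X'),
    runit X' ∘ tensm f idm = f ∘ runit X;
  pentagon : forall W X Y Z,
    tensm (id_ W) (assoc X Y Z) ∘ assoc W (tens X Y) Z
        ∘ tensm (assoc W X Y) (id_ Z)
      = assoc W X (tens Y Z) ∘ assoc (tens W X) Y Z;
  triangle : forall X Y,
    tensm (id_ X) (lunit Y) ∘ assoc X unit_ob Y = tensm (runit X) (id_ Y) }.
Arguments unit_ob {_}.
Arguments tensm {_ _ _ _ _} _ _.
Arguments assoc {_} _ _ _.
Arguments lunit {_} _.
Arguments runit {_} _.
Notation "X ⊗ Y" := (tens X Y) : cat_scope.
Notation "f ⊠ g" := (tensm f g) (at level 38, left associativity) : cat_scope.

Record braided := Braided {
  br_mon :> monoidal;
  braid : forall X Y : br_mon, iso (X ⊗ Y) (Y ⊗ X);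
  braid_nat : forall X X' Y Y' (f : X ~> X') (g : Y ~> Y'),
    braid X' Y' ∘ (f ⊠ g) = (g ⊠ f) ∘ braid X Y;
  hexagon1 : forall X Y Z,
    assoc Y Z X ∘ braid X (Y ⊗ Z) ∘ assoc X Y Z
      = (id_ Y ⊠ braid X Z) ∘ assoc Y X Z ∘ (braid X Y ⊠ id_ Z);
  hexagon2 : forall X Y Z,
    iso_inv (assoc Z X Y) ∘ braid (X ⊗ Y) Z ∘ iso_inv (assoc X Y Z)
      = (braid X Z ⊠ id_ Y) ∘ iso_inv (assoc X Z Y) ∘ (id_ X ⊠ braid Y Z) }.
Arguments braid {_} _ _.

(* ihom X Y is [X, Y], with [X, -] right adjoint to - ⊗ X. *)
Record braided_closed := BraidedClosed {
  bc_br :> braided;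
  ihom : bc_br -> bc_br -> bc_br;
  ev : forall X Y : bc_br, ihom X Y ⊗ X ~> Y;
  curry : forall Z X Y : bc_br, (Z ⊗ X ~> Y) -> (Z ~> ihom X Y);
  ev_curry : forall Z X Y (h : Z ⊗ X ~> Y), ev X Y ∘ (curry h ⊠ id_ X) = h;
  curry_ev : forall Z X Y (k : Z ~> ihom X Y),
    curry (ev X Y ∘ (k ⊠ id_ X)) = k }.
Arguments ihom {_} _ _.
Arguments ev {_} _ _.
Arguments curry {_ _ _ _} _.

Section CategoryLemmas.
Variable C : category.
Implicit Types X Y Z W : C.

Lemma compE2 X Y Z (g : Y ~> Z) (f : X ~> Y) k : g ∘ f = k ->
  forall T (h : Z ~> T), h ∘ g ∘ f = h ∘ k.
Proof. by move=> E T h; rewrite -compA E. Qed.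

Lemma compE3 W X Y Z (g : Y ~> Z) (f : X ~> Y) (e : W ~> X) k :
  g ∘ f ∘ e = k -> forall T (h : Z ~> T), h ∘ g ∘ f ∘ e = h ∘ k.
Proof. by move=> E T h; rewrite -E !compA. Qed.

Lemma isoK X Y (i : iso X Y) Z (h : X ~> Z) : h ∘ iso_inv i ∘ i = h.
Proof. by rewrite -compA iso_homK compf1. Qed.

Lemma isoVK X Y (i : iso X Y) Z (h : Y ~> Z) : h ∘ i ∘ iso_inv i = h.
Proof. by rewrite -compA iso_invK compf1. Qed.

Lemma iso_epi X Y (i : iso X Y) Z (g h : Y ~> Z) : g ∘ i = h ∘ i -> g = h.
Proof. by move=> E; rewrite -(isoVK i g) E isoVK. Qed.

Lemma isoV_epi X Y (i : iso X Y) Z (g h : X ~> Z) :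
  g ∘ iso_inv i = h ∘ iso_inv i -> g = h.
Proof. by move=> E; rewrite -(isoK i g) E isoK. Qed.

Lemma iso_mono X Y (i : iso X Y) Z (g h : Z ~> X) : i ∘ g = i ∘ h -> g = h.
Proof.
move=> E; rewrite -(comp1f g) -(comp1f h) -(iso_homK i).
by rewrite -!compA E.
Qed.

Lemma isoV_mono X Y (i : iso X Y) Z (g h : Z ~> Y) :
  iso_inv i ∘ g = iso_inv i ∘ h -> g = h.
Proof.
move=> E; rewrite -(comp1f g) -(comp1f h) -(iso_invK i).
by rewrite -!compA E.
Qed.

Lemma iso_swap X Y (i : iso X Y) Z (g : X ~> Z) (h : Y ~> Z) :
  g = h ∘ i -> g ∘ iso_inv i = h.
Proof. by move=> ->; rewrite isoVK. Qed.
End CategoryLemmas.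

Section MonoidalLemmas.
Variable V : monoidal.
Implicit Types W X Y Z : V.

Lemma tensmMl X Y Z W (f : Y ~> Z) (g : X ~> Y) :
  (f ∘ g) ⊠ id_ W = (f ⊠ id_ W) ∘ (g ⊠ id_ W).
Proof. by rewrite -tensmM compf1. Qed.

Lemma tensmMr X Y Z W (f : Y ~> Z) (g : X ~> Y) :
  id_ W ⊠ (f ∘ g) = (id_ W ⊠ f) ∘ (id_ W ⊠ g).
Proof. by rewrite -tensmM compf1. Qed.

Lemma tensm_lr X X' Y Y' (f : X ~> X') (g : Y ~> Y') :
  (f ⊠ idm) ∘ (idm ⊠ g) = f ⊠ g.
Proof. by rewrite -tensmM compf1 comp1f. Qed.

Lemma tensm_rl X X' Y Y' (f : X ~> X') (g : Y ~> Y') :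
  (idm ⊠ g) ∘ (f ⊠ idm) = f ⊠ g.
Proof. by rewrite -tensmM compf1 comp1f. Qed.

Lemma tensm_swap X X' Y Y' (f : X ~> X') (g : Y ~> Y') :
  (idm ⊠ g) ∘ (f ⊠ idm) = (f ⊠ idm) ∘ (idm ⊠ g).
Proof. by rewrite tensm_lr tensm_rl. Qed.

Definition tens_iso X X' Y Y' (i : iso X X') (j : iso Y Y') :
  iso (X ⊗ Y) (X' ⊗ Y').
Proof.
exists (i ⊠ j) (iso_inv i ⊠ iso_inv j).
- by rewrite -tensmM !iso_homK tensm1.
- by rewrite -tensmM !iso_invK tensm1.
Defined.

Definition id_iso X : iso X X := Iso (comp1f (id_ X)) (comp1f (id_ X)).

Lemma unit_faithl X Y (f g : X ~> Y) :
  id_ unit_ob ⊠ f = id_ unit_ob ⊠ g -> f = g.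
Proof.
by move=> E; apply: (iso_epi (i := lunit X)); rewrite -!lunit_nat E.
Qed.

Lemma unit_faithr X Y (f g : X ~> Y) :
  f ⊠ id_ unit_ob = g ⊠ id_ unit_ob -> f = g.
Proof.
by move=> E; apply: (iso_epi (i := runit X)); rewrite -!runit_nat E.
Qed.

Lemma assocV_nat X X' Y Y' Z Z' (f : X ~> X') (g : Y ~> Y') (h : Z ~> Z') :
  iso_inv (assoc X' Y' Z') ∘ (f ⊠ (g ⊠ h))
    = (f ⊠ g) ⊠ h ∘ iso_inv (assoc X Y Z).
Proof.
apply: (iso_epi (i := assoc X Y Z)); rewrite isoK.
by rewrite -compA -assoc_nat compA iso_homK comp1f.
Qed.

Lemma lunitV_nat X X' (f : X ~> X') :
  iso_inv (lunit X') ∘ f = (idm ⊠ f) ∘ iso_inv (lunit X).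
Proof.
apply: (iso_epi (i := lunit X)); rewrite isoK.
by rewrite -compA -lunit_nat compA iso_homK comp1f.
Qed.

Lemma runitV_nat X X' (f : X ~> X') :
  iso_inv (runit X') ∘ f = (f ⊠ idm) ∘ iso_inv (runit X).
Proof.
apply: (iso_epi (i := runit X)); rewrite isoK.
by rewrite -compA -runit_nat compA iso_homK comp1f.
Qed.

Lemma lunit_tens X Y : lunit (X ⊗ Y) ∘ assoc unit_ob X Y = lunit X ⊠ idm.
Proof.
apply: unit_faithl; rewrite tensmMr.
pose i := assoc (unit_ob : V) (unit_ob ⊗ X) Y.
pose j := tens_iso (assoc (unit_ob : V) unit_ob X) (id_iso Y).
apply: (iso_epi (i := i)); apply: (iso_epi (i := j)) => /=.
rewrite (compE3 (pentagon _ _ _ _)) compA triangle -assoc_nat.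
by rewrite -(tensm1 X Y) -assoc_nat -(triangle unit_ob X) tensmMl compA.
Qed.

Lemma runit_tens X Y : (idm ⊠ runit Y) ∘ assoc X Y unit_ob = runit (X ⊗ Y).
Proof.
apply: unit_faithr; rewrite tensmMl.
apply: (iso_mono (i := assoc X Y unit_ob)).
rewrite compA assoc_nat -(triangle Y unit_ob) tensmMr.
rewrite -(triangle (X ⊗ Y)) compA -{1}(tensm1 X Y) assoc_nat.
by rewrite -!compA; congr (_ ∘ _); rewrite -pentagon !compA.
Qed.

Lemma lunit_runit_unit : lunit unit_ob = runit unit_ob :> (_ ~> (unit_ob : V)).
Proof.
apply: unit_faithr; rewrite -triangle -lunit_tens.
congr (_ ∘ _); apply: (iso_mono (i := lunit unit_ob)).
by rewrite lunit_nat.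
Qed.

Lemma triangleV X Y :
  assoc X unit_ob Y ∘ (iso_inv (runit X) ⊠ idm) = idm ⊠ iso_inv (lunit Y).
Proof.
apply: (iso_mono (i := tens_iso (id_iso X) (lunit Y))) => /=.
by rewrite compA triangle -!tensmM !iso_invK !compf1 tensm1.
Qed.
End MonoidalLemmas.

Section BraidedLemmas.
Variable V : braided.
Implicit Types W X Y Z : V.

Lemma braid_runit X : runit X = lunit X ∘ braid X unit_ob :> (_ ~> _).
Proof.
pose g := lunit X ∘ braid X unit_ob.
have E : g ∘ (runit X ⊠ idm) = g ∘ (g ⊠ idm).
  rewrite -(triangle X unit_ob) /g !compA.
  rewrite (compE2 (braid_nat _ _)) lunit_runit_unit -triangle !compA.
  rewrite (compE3 (hexagon1 _ _ _)) !compA lunit_nat.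
  rewrite (compE2 (lunit_nat _)) !compA (compE2 (lunit_tens _ _)).
  by rewrite tensmMl compA.
apply: unit_faithr; apply: (iso_mono (i := braid X unit_ob)).
by apply: (iso_mono (i := lunit X)); rewrite !compA -E.
Qed.

Lemma braid_lunit X : runit X ∘ braid unit_ob X = lunit X.
Proof.
pose g := runit X ∘ braid unit_ob X.
have E : g ∘ (idm ⊠ lunit X) = g ∘ (idm ⊠ g).
  rewrite /g (tensmMr _ (runit X)) compA -(iso_swap (esym (runit_tens unit_ob X))).
  rewrite !compA (compE2 (esym (runit_nat _))) !compA -runit_nat.
  rewrite (compE3 (esym (hexagon2 unit_ob unit_ob X))) !compA.
  rewrite (compE2 (iso_swap (esym (triangle _ _)))).
  rewrite (compE2 (esym (braid_nat _ _))) !compA lunit_runit_unit.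
  by rewrite (compE2 (iso_swap (esym (triangle _ _)))).
apply: unit_faithl; apply: (iso_mono (i := braid unit_ob X)).
by apply: (iso_mono (i := runit X)); rewrite !compA -E.
Qed.

Lemma braid_lunitV X : braid unit_ob X ∘ iso_inv (lunit X) = iso_inv (runit X).
Proof.
apply: (iso_mono (i := runit X)).
by rewrite compA braid_lunit !iso_invK.
Qed.

Lemma braidE_lunit X : braid unit_ob X = iso_inv (runit X) ∘ lunit X :> (_ ~> _).
Proof.
apply: (iso_mono (i := runit X)).
by rewrite compA braid_lunit iso_invK comp1f.
Qed.

Lemma braidE_runit X : braid X unit_ob = iso_inv (lunit X) ∘ runit X :> (_ ~> _).
Proof.
apply: (iso_mono (i := lunit X)).
by rewrite compA -braid_runit iso_invK comp1f.
Qed.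
End BraidedLemmas.

Section MonoidalLemmas2.
Variable V : monoidal.
Implicit Types W X Y Z : V.

Lemma assoc_natl X X' Y Z (f : X ~> X') :
  assoc X' Y Z ∘ ((f ⊠ idm) ⊠ idm) = (f ⊠ idm) ∘ assoc X Y Z.
Proof. by rewrite assoc_nat tensm1. Qed.

Lemma assoc_natm X Y Y' Z (f : Y ~> Y') :
  assoc X Y' Z ∘ ((idm ⊠ f) ⊠ idm) = (idm ⊠ (f ⊠ idm)) ∘ assoc X Y Z.
Proof. by rewrite assoc_nat. Qed.

Lemma assoc_natr X Y Z Z' (f : Z ~> Z') :
  assoc X Y Z' ∘ (idm ⊠ f) = (idm ⊠ (idm ⊠ f)) ∘ assoc X Y Z.
Proof. by rewrite -assoc_nat tensm1. Qed.

Lemma assocV_natl X X' Y Z (f : X ~> X') :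
  iso_inv (assoc X' Y Z) ∘ (f ⊠ idm)
    = ((f ⊠ idm) ⊠ idm) ∘ iso_inv (assoc X Y Z).
Proof. by rewrite -assocV_nat tensm1. Qed.

Lemma assocV_natm X Y Y' Z (f : Y ~> Y') :
  iso_inv (assoc X Y' Z) ∘ (idm ⊠ (f ⊠ idm))
    = ((idm ⊠ f) ⊠ idm) ∘ iso_inv (assoc X Y Z).
Proof. by rewrite assocV_nat. Qed.

Lemma assocV_natr X Y Z Z' (f : Z ~> Z') :
  iso_inv (assoc X Y Z') ∘ (idm ⊠ (idm ⊠ f))
    = (idm ⊠ f) ∘ iso_inv (assoc X Y Z).
Proof. by rewrite assocV_nat tensm1. Qed.

Lemma pentagon_mid W X Y Z :
  (idm ⊠ assoc X Y Z) ∘ assoc W (X ⊗ Y) Z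
    = assoc W X (Y ⊗ Z) ∘ assoc (W ⊗ X) Y Z
      ∘ (iso_inv (assoc W X Y) ⊠ idm).
Proof.
rewrite -pentagon -!compA -tensmMl iso_invK tensm1 !compA.
by rewrite compf1.
Qed.

Lemma pentagon_midV W X Y Z :
  (idm ⊠ iso_inv (assoc X Y Z)) ∘ assoc W X (Y ⊗ Z)
    = assoc W (X ⊗ Y) Z ∘ (assoc W X Y ⊠ idm)
      ∘ iso_inv (assoc (W ⊗ X) Y Z).
Proof.
apply: esym; apply: iso_swap; rewrite -compA -pentagon !compA.
by rewrite -tensmMr iso_homK tensm1 comp1f.
Qed.

Lemma pentagon_V W X Y Z :
  iso_inv (assoc W X (Y ⊗ Z)) ∘ (idm ⊠ assoc X Y Z)
    = assoc (W ⊗ X) Y Z ∘ (iso_inv (assoc W X Y) ⊠ idm)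
      ∘ iso_inv (assoc W (X ⊗ Y) Z).
Proof.
apply: esym; apply: iso_swap.
apply: (iso_mono (i := assoc W X (Y ⊗ Z))); rewrite !compA -pentagon_mid.
by rewrite iso_invK comp1f.
Qed.
End MonoidalLemmas2.

Section Slide.
Variable V : braided.
Implicit Types K W X Y Z C : V.

(* Locked so that rewriting with compA does not unfold it. *)
Definition slide K X Y : K ⊗ (X ⊗ Y) ~> X ⊗ (K ⊗ Y) :=
  locked (assoc X K Y ∘ (braid K X ⊠ idm) ∘ iso_inv (assoc K X Y)).

Lemma slideE K X Y :
  slide K X Y = assoc X K Y ∘ (braid K X ⊠ idm) ∘ iso_inv (assoc K X Y).
Proof. by rewrite /slide -lock. Qed.

Lemma slide_assoc K X Y :
  slide K X Y ∘ assoc K X Y = assoc X K Y ∘ (braid K X ⊠ idm).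
Proof. by rewrite slideE isoK. Qed.

Lemma slide_natl K K' X Y (f : K ~> K') :
  slide K' X Y ∘ (f ⊠ idm) = (idm ⊠ (f ⊠ idm)) ∘ slide K X Y.
Proof.
rewrite !slideE (compE2 (assocV_natl _ _ _)) !compA.
rewrite (compE2 (esym (tensmMl _ _ _))) braid_nat tensmMl !compA.
by rewrite assoc_natm.
Qed.

Lemma slide_natm K X X' Y (f : X ~> X') :
  slide K X' Y ∘ (idm ⊠ (f ⊠ idm)) = (f ⊠ idm) ∘ slide K X Y.
Proof.
rewrite !slideE (compE2 (assocV_natm _ _ _)) !compA.
rewrite (compE2 (esym (tensmMl _ _ _))) braid_nat tensmMl !compA.
by rewrite assoc_natl.
Qed.

Lemma slide_natr K X Y Y' (f : Y ~> Y') :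
  slide K X Y' ∘ (idm ⊠ (idm ⊠ f)) = (idm ⊠ (idm ⊠ f)) ∘ slide K X Y.
Proof.
rewrite !slideE (compE2 (assocV_natr _ _ _)) !compA.
by rewrite (compE2 (esym (tensm_swap _ _))) !compA assoc_natr.
Qed.

Lemma hexagon1' X Y Z :
  braid X (Y ⊗ Z) ∘ assoc X Y Z
    = iso_inv (assoc Y Z X) ∘ (idm ⊠ braid X Z) ∘ assoc Y X Z
      ∘ (braid X Y ⊠ idm).
Proof.
apply: (iso_mono (i := assoc Y Z X)).
by rewrite !compA hexagon1 iso_invK comp1f.
Qed.

Lemma hexagon2' X Y Z :
  braid (X ⊗ Y) Z ∘ iso_inv (assoc X Y Z)
    = assoc Z X Y ∘ (braid X Z ⊠ id_ Y) ∘ iso_inv (assoc X Z Y)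
      ∘ (id_ X ⊠ braid Y Z).
Proof.
apply: (isoV_mono (i := assoc Z X Y)).
by rewrite !compA hexagon2 iso_homK comp1f.
Qed.

Lemma slide_tensl K K' X Y :
  (idm ⊠ assoc K K' Y) ∘ slide (K ⊗ K') X Y
    = slide K X (K' ⊗ Y) ∘ (idm ⊠ slide K' X Y) ∘ assoc K K' (X ⊗ Y).
Proof.
apply: (iso_epi (i := assoc (K ⊗ K') X Y)).
apply: (isoV_epi (i := tens_iso (assoc K K' X) (id_iso Y))) => /=.
rewrite (compE2 (slide_assoc _ _ _)) !compA.
rewrite (compE2 (esym (tensmMl _ _ _))) hexagon2' !tensmMl !compA.
rewrite pentagon.
rewrite (compE3 (esym (pentagon_mid _ _ _ _))) !compA.
rewrite (compE2 (esym (tensmMr _ _ _))) slide_assoc tensmMr !compA.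
rewrite (compE2 (esym (assoc_natm _ _ _))) !compA.
rewrite (compE2 (pentagon_mid _ _ _ _)) !compA slide_assoc.
by rewrite (compE2 (esym (assoc_natl _ _ _))) !compA.
Qed.

Lemma slide_tensm K X C Y :
  assoc X C (K ⊗ Y) ∘ slide K (X ⊗ C) Y
    = (idm ⊠ slide K C Y) ∘ slide K X (C ⊗ Y) ∘ (idm ⊠ assoc X C Y).
Proof.
apply: (iso_epi (i := assoc K (X ⊗ C) Y)).
apply: (iso_epi (i := tens_iso (assoc K X C) (id_iso Y))) => /=.
rewrite (compE2 (slide_assoc _ _ _)) !compA.
rewrite (compE2 (esym (tensmMl _ _ _))) hexagon1' !tensmMl !compA.
rewrite -pentagon_mid (compE3 (pentagon _ _ _ _)) !compA.
rewrite (compE2 (slide_assoc _ _ _)) !compA.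
rewrite (compE2 (esym (assoc_natl _ _ _))) !compA !slideE !tensmMr.
rewrite (compE2 (pentagon_midV _ _ _ _)) !compA isoK.
by rewrite (compE2 (assoc_natm _ _ _)) !compA.
Qed.

Lemma slide_tensr K X C Y :
  assoc X (K ⊗ C) Y ∘ (slide K X C ⊠ idm)
    = (idm ⊠ iso_inv (assoc K C Y)) ∘ slide K X (C ⊗ Y)
      ∘ (idm ⊠ assoc X C Y) ∘ assoc K (X ⊗ C) Y.
Proof.
apply: (iso_epi (i := tens_iso (assoc K X C) (id_iso Y))) => /=.
rewrite (compE3 (pentagon _ _ _ _)) !compA.
rewrite (compE2 (slide_assoc _ _ _)) !compA.
rewrite (compE2 (esym (assoc_natl _ _ _))) !compA.
rewrite pentagon_midV isoK.
rewrite (compE2 (esym (tensmMl _ _ _))) slide_assoc tensmMl.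
by rewrite !compA.
Qed.
End Slide.

(* (W ⊗ K) ⊗ (X ⊗ C) ≅ (W ⊗ X) ⊗ (K ⊗ C), using c_{K,X}. *)
Definition interchange (V : braided) (W K X C : V) :
    (W ⊗ K) ⊗ (X ⊗ C) ~> (W ⊗ X) ⊗ (K ⊗ C) :=
  iso_inv (assoc W X (K ⊗ C))
  ∘ (id_ W ⊠ (assoc X K C ∘ (braid K X ⊠ id_ C) ∘ iso_inv (assoc K X C)))
  ∘ assoc W K (X ⊗ C).

Lemma interchangeE (V : braided) (W K X C : V) :
  interchange W K X C
    = iso_inv (assoc W X (K ⊗ C)) ∘ (idm ⊠ slide K X C) ∘ assoc W K (X ⊗ C).
Proof. by rewrite slideE. Qed.

Section CurryLemmas.
Variable V : braided_closed.
Implicit Types W X Y Z : V.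

Lemma curry_inj Z X Y (k k' : Z ~> ihom X Y) :
  ev X Y ∘ (k ⊠ idm) = ev X Y ∘ (k' ⊠ idm) -> k = k'.
Proof. by move=> E; rewrite -(curry_ev k) E curry_ev. Qed.

Lemma curry_comp W Z X Y (h : Z ⊗ X ~> Y) (k : W ~> Z) :
  curry h ∘ k = curry (h ∘ (k ⊠ idm)).
Proof. by apply: curry_inj; rewrite tensmMl compA !ev_curry. Qed.

Section Action.
Variables (K X N B : V) (s : K ⊗ X ~> X ⊗ B) (mu : N ⊗ B ~> N).
Variables (mK : K ⊗ K ~> K) (mB : B ⊗ B ~> B).
Variables (eK : unit_ob ~> K) (eB : unit_ob ~> B).

(* Any s : K ⊗ X ~> X ⊗ B compatible with monoid structures on K and B makes
   [X, N] a K-module when N is a B-module. Both the [C, B]-action on [X, N] for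
   a C-comodule X (s = conv_slide) and the A-action on [Z, L] for an A-module L
   (s = braid A Z) are instances; slide_actA and slide_act1 give their laws. *)
Definition slide_act : ihom X N ⊗ K ~> ihom X N :=
  curry (mu ∘ (ev X N ⊠ id_ B) ∘ iso_inv (assoc (ihom X N) X B)
         ∘ (id_ (ihom X N) ⊠ s) ∘ assoc (ihom X N) K X).

Lemma slide_actA :
  mu ∘ (mu ⊠ idm) = mu ∘ (idm ⊠ mB) ∘ assoc N B B ->
  s ∘ (mK ⊠ idm) = (idm ⊠ mB) ∘ assoc X B B ∘ (s ⊠ idm)
     ∘ iso_inv (assoc K X B) ∘ (idm ⊠ s) ∘ assoc K K X ->
  slide_act ∘ (slide_act ⊠ idm)
    = slide_act ∘ (idm ⊠ mK) ∘ assoc (ihom X N) K K.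
Proof.
move=> muA sM; apply: curry_inj; rewrite !tensmMl !compA !ev_curry.
rewrite (compE2 (assoc_natl _ _ _)) !compA (compE2 (tensm_swap _ _)) !compA.
rewrite (compE2 (assocV_natl _ _ _)) !compA.
rewrite (compE2 (esym (tensmMl _ _ _))) {1}/slide_act ev_curry.
rewrite !tensmMl !compA muA.
rewrite (compE2 (assoc_natm _ _ _)) !compA.
rewrite (compE2 (esym (tensmMr _ _ _))) sM.
rewrite !tensmMr !compA (compE3 (pentagon _ _ _ _)) !compA.
rewrite (compE2 (esym (assoc_natr _ _ _))) !compA.
rewrite (compE2 (pentagon_midV _ _ _ _)) !compA.
rewrite (compE2 (esym (assoc_natm _ _ _))) !compA.
rewrite (compE2 (pentagon_mid _ _ _ _)) !compA.
rewrite (compE2 (esym (assoc_natr _ _ _))) !compA isoK.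
rewrite (compE2 (tensm_lr _ (mB : _ ~> _))).
by rewrite (compE2 (assoc_natl _ _ _)) !compA (compE2 (tensm_rl _ _)).
Qed.

Lemma slide_act1 :
  mu ∘ (idm ⊠ eB) = runit N ->
  s ∘ (eK ⊠ idm) ∘ iso_inv (lunit X) = (idm ⊠ eB) ∘ iso_inv (runit X) ->
  slide_act ∘ (idm ⊠ eK) = runit (ihom X N).
Proof.
move=> mu1 s1; apply: curry_inj; rewrite tensmMl compA ev_curry.
rewrite (compE2 (assoc_natm _ _ _)) !compA (compE2 (esym (tensmMr _ _ _))).
have {s1}-> : s ∘ (eK ⊠ idm) = (idm ⊠ eB) ∘ iso_inv (runit X) ∘ lunit X.
  by rewrite -s1 isoK.
rewrite !tensmMr !compA (compE2 (assocV_natr _ _ _)) !compA.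
rewrite (compE2 (tensm_lr _ _)) -(tensm_rl (ev X N)) !compA mu1 runit_nat.
rewrite (compE2 (triangle _ _)).
rewrite (compE2 (iso_swap (esym (runit_tens _ _)))).
rewrite (compE2 (esym (tensmMr _ _ _))) iso_invK tensm1 compf1 //.
Qed.
End Action.

Section Convolution.

(* The action on [X, N] induced by chi and mu. With X = C, N = B, chi the
   comultiplication and mu the multiplication this is the convolution product
   of [C, B]. *)
Definition conv_act (X C N B : V) (chi : X ~> X ⊗ C) (mu : N ⊗ B ~> N) :
    ihom X N ⊗ ihom C B ~> ihom X N :=
  curry (mu ∘ (ev X N ⊠ ev C B) ∘ interchange (ihom X N) (ihom C B) X C
         ∘ (idm ⊠ chi)).

Definition conv_unit (C B : V) (e : C ~> unit_ob) (u : unit_ob ~> B) :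
    unit_ob ~> ihom C B := curry (u ∘ e ∘ lunit C).

Definition conv_slide (X C B : V) (chi : X ~> X ⊗ C) :
    ihom C B ⊗ X ~> X ⊗ B :=
  locked ((idm ⊠ ev C B) ∘ slide (ihom C B) X C ∘ (idm ⊠ chi)).

Lemma conv_slideE X C B (chi : X ~> X ⊗ C) :
  conv_slide B chi
    = (idm ⊠ ev C B) ∘ slide (ihom C B) X C ∘ (idm ⊠ chi).
Proof. by rewrite /conv_slide -lock. Qed.

Lemma conv_actE X C N B (chi : X ~> X ⊗ C) (mu : N ⊗ B ~> N) :
  conv_act chi mu = slide_act (conv_slide B chi) mu.
Proof.
rewrite /conv_act /slide_act conv_slideE interchangeE; congr curry.
rewrite !tensmMr !compA (compE2 (assoc_natr _ _ _)) !compA.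
by rewrite (compE2 (assocV_natr _ _ _)) !compA (compE2 (tensm_lr _ _)).
Qed.

Lemma ev_conv_act X C N B (chi : X ~> X ⊗ C) (mu : N ⊗ B ~> N) :
  ev X N ∘ (conv_act chi mu ⊠ idm)
    = mu ∘ (ev X N ⊠ idm) ∘ iso_inv (assoc (ihom X N) X B)
      ∘ (idm ⊠ conv_slide B chi) ∘ assoc (ihom X N) (ihom C B) X.
Proof. by rewrite conv_actE ev_curry. Qed.

Lemma conv_slideM X C B (chi : X ~> X ⊗ C) (D : C ~> C ⊗ C)
    (m : B ⊗ B ~> B) :
  assoc X C C ∘ (chi ⊠ idm) ∘ chi = (idm ⊠ D) ∘ chi ->
  conv_slide B chi ∘ (conv_act D m ⊠ idm)
    = (idm ⊠ m) ∘ assoc X B B ∘ (conv_slide B chi ⊠ idm)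
      ∘ iso_inv (assoc (ihom C B) X B) ∘ (idm ⊠ conv_slide B chi)
      ∘ assoc (ihom C B) (ihom C B) X.
Proof.
move=> chiA; set K := ihom C B.
rewrite {1}conv_slideE -/K.
rewrite (compE2 (tensm_swap _ _)) !compA.
rewrite (compE2 (slide_natl _ _ _)) !compA -tensmMr ev_conv_act -/K.
rewrite {1}conv_slideE !tensmMr !compA.
rewrite (compE2 (esym (tensmMr _ (iso_inv _) _))) assocV_natr tensmMr !compA.
rewrite (compE2 (esym (tensmMr _ (ev C B ⊠ _) _))) tensm_lr.
rewrite (compE2 (esym (tensmMr _ _ (assoc K K C)))) -assoc_natr tensmMr !compA.
rewrite (compE2 (esym (slide_natr _ _ _))) !compA.
rewrite (compE2 (esym (tensmMr _ _ chi))) -chiA !tensmMr !compA.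
rewrite (compE2 (slide_tensl _ _ _ _)) !compA.
rewrite (compE2 (esym (slide_natr _ _ _))) !compA.
rewrite (compE2 (assoc_natr _ _ _)) !compA.
rewrite (compE2 (esym (tensmMr K _ (slide _ _ _)))).
rewrite (compE2 (esym (tensmMr K _ (idm ⊠ assoc _ _ _)))) -slide_tensm.
rewrite tensmMr !compA.
apply: esym; rewrite conv_slideE -/K !tensmMl !tensmMr !compA.
rewrite (compE2 (assocV_natr _ _ _)) !compA.
rewrite (compE2 (esym (tensm_swap _ _))) !compA.
rewrite (compE2 (esym (tensm_swap _ _))) !compA.
rewrite (compE2 (tensm_lr _ _)) (compE2 (assoc_nat _ _ _)) !compA.
rewrite (compE2 (esym (assocV_natm _ _ _))) !compA.
rewrite (compE2 (esym (tensmMr _ _ (slide _ _ _)))) -slide_natm tensmMr !compA.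
rewrite (compE2 (slide_tensr _ _ _ _)) !compA isoVK.
rewrite (compE2 (esym (assoc_natr _ _ _))) !compA.
by rewrite (compE2 (esym (assoc_natr _ _ _))) !compA.
Qed.

Lemma conv_slide1 X C B (chi : X ~> X ⊗ C) (e : C ~> unit_ob)
    (u : unit_ob ~> B) :
  runit X ∘ (idm ⊠ e) ∘ chi = idm ->
  conv_slide B chi ∘ (conv_unit e u ⊠ idm) ∘ iso_inv (lunit X)
    = (idm ⊠ u) ∘ iso_inv (runit X).
Proof.
move=> chi1; rewrite conv_slideE.
rewrite (compE2 (tensm_swap _ _)) !compA.
rewrite (compE2 (slide_natl _ _ _)) !compA -tensmMr ev_curry.
rewrite (compE2 (esym (lunitV_nat _))) !compA !tensmMr.
have E : slide unit_ob X C ∘ iso_inv (lunit (X ⊗ C))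
    = idm ⊠ iso_inv (lunit C).
  rewrite slideE -triangleV -braid_lunitV tensmMl !compA.
  rewrite -!compA; congr (_ ∘ (_ ∘ _)).
  apply: (iso_mono (i := assoc unit_ob X C)); rewrite compA iso_invK comp1f.
  apply: (iso_mono (i := lunit _)); rewrite compA iso_invK lunit_tens.
  by rewrite -tensmMl iso_invK tensm1.
rewrite (compE2 E) (compE2 (esym (tensmMr _ _ _))) iso_invK tensm1 compf1.
rewrite -!compA; congr (_ ∘ _).
by apply: (iso_mono (i := runit X)); rewrite !compA chi1 iso_invK.
Qed.
Lemma conv_act_unitl C B (D : C ~> C ⊗ C) (e : C ~> unit_ob)
    (m : B ⊗ B ~> B) (u : unit_ob ~> B) :
  lunit C ∘ (e ⊠ idm) ∘ D = idm -> m ∘ (u ⊠ idm) = lunit B ->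
  conv_act D m ∘ (conv_unit e u ⊠ idm) = lunit (ihom C B).
Proof.
move=> counitl unitl; set K := ihom C B.
have lE : lunit (K ⊗ C) ∘ slide K unit_ob C = idm ⊠ lunit C.
  rewrite slideE !compA lunit_tens -tensmMl -braid_runit.
  by rewrite (iso_swap (esym (triangle _ _))).
have evE : lunit B ∘ (e ⊠ idm) ∘ conv_slide B D = ev C B.
  rewrite conv_slideE !compA (compE2 (esym (tensm_swap _ _))) !compA.
  rewrite lunit_nat (compE2 (esym (slide_natm _ _ _))) !compA.
  rewrite (compE2 lE) (compE2 (esym (tensmMr _ _ _))).
  by rewrite (compE2 (esym (tensmMr _ _ _))) ?compA counitl tensm1 compf1.
apply: curry_inj; rewrite tensmMl compA ev_conv_act -/K.
rewrite (compE2 (assoc_natl _ _ _)) !compA.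
rewrite (compE2 (tensm_swap _ _)) !compA.
rewrite (compE2 (assocV_natl _ _ _)) !compA.
rewrite (compE2 (esym (tensmMl _ _ _))) ev_curry !tensmMl !compA unitl.
have E : (lunit C ⊠ id_ B) ∘ iso_inv (assoc unit_ob C B) = lunit (C ⊗ B).
  by rewrite -lunit_tens isoVK.
by rewrite (compE2 E) (compE2 (lunit_nat _)) !compA evE (compE2 (lunit_tens _ _)).
Qed.

Definition ihom_map X Y N (k : X ~> Y) : ihom Y N ~> ihom X N :=
  curry (ev Y N ∘ (idm ⊠ k)).

Lemma ihom_map1 X N : ihom_map N (id_ X) = idm.
Proof. by apply: curry_inj; rewrite ev_curry. Qed.

Lemma ihom_mapM X Y Z N (k : Y ~> Z) (h : X ~> Y) :
  ihom_map N (k ∘ h) = ihom_map N h ∘ ihom_map N k.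
Proof.
apply: curry_inj; rewrite ev_curry tensmMl compA ev_curry.
by rewrite (compE2 (tensm_swap _ _)) !compA ev_curry tensmMr compA.
Qed.

Lemma slide_act_nat K K' X Y N B (s : K ⊗ X ~> X ⊗ B)
    (s' : K' ⊗ Y ~> Y ⊗ B) (mu : N ⊗ B ~> N) (k : X ~> Y) (g : K' ~> K) :
  (k ⊠ idm) ∘ s ∘ (g ⊠ idm) = s' ∘ (idm ⊠ k) ->
  slide_act s mu ∘ (ihom_map N k ⊠ g) = ihom_map N k ∘ slide_act s' mu.
Proof.
move=> sE; apply: curry_inj; rewrite !tensmMl !compA !ev_curry.
rewrite (compE2 (tensm_swap _ _)) !compA ev_curry.
rewrite (compE2 (assoc_natr _ _ _)) !compA.
rewrite (compE2 (esym (tensmMr _ _ _))) -sE !tensmMr !compA.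
rewrite (compE2 (assocV_natm _ _ _)) !compA.
rewrite (compE2 (esym (tensmMl _ _ _))).
rewrite (compE2 (assoc_nat _ _ _)) !compA -(tensm_lr (ihom_map N k)) !compA.
rewrite (compE2 (tensm_swap _ _)) !compA.
rewrite (compE2 (assocV_natl _ _ _)) !compA.
by rewrite (compE2 (esym (tensmMl _ _ _))) ev_curry.
Qed.

Lemma conv_slide_nat X Y C D B (chi : X ~> X ⊗ C) (chi' : Y ~> Y ⊗ D)
    (k : X ~> Y) (g : C ~> D) :
  chi' ∘ k = (k ⊠ g) ∘ chi ->
  (k ⊠ idm) ∘ conv_slide B chi ∘ (ihom_map B g ⊠ idm)
    = conv_slide B chi' ∘ (idm ⊠ k).
Proof.
move=> E; rewrite !conv_slideE !compA.
rewrite (compE2 (tensm_swap _ _)) !compA (compE2 (slide_natl _ _ _)) !compA.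
rewrite (compE2 (esym (tensmMr _ _ _))) ev_curry.
rewrite (compE2 (esym (tensmMr _ chi' k))) E -(tensm_lr k g) !tensmMr !compA.
rewrite (compE2 (slide_natm _ _ _)) !compA (compE2 (slide_natr _ _ _)) !compA.
by rewrite tensm_swap.
Qed.

End Convolution.

End CurryLemmas.

#[local] Obligation Tactic := intros; simpl in *.

Record monoid (V : monoidal) := Monoid {
  mon_ob :> V;
  mul : mon_ob ⊗ mon_ob ~> mon_ob;
  one : unit_ob ~> mon_ob;
  mulA : mul ∘ (mul ⊠ idm) = mul ∘ (idm ⊠ mul) ∘ assoc mon_ob mon_ob mon_ob;
  mul1l : mul ∘ (one ⊠ idm) = lunit mon_ob;
  mul1r : mul ∘ (idm ⊠ one) = runit mon_ob }.
Arguments mul {V} _.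
Arguments one {V} _.

Record mon_hom (V : monoidal) (A B : monoid V) := MonHom {
  mon_map :> A ~> B;
  mon_mul : mon_map ∘ mul A = mul B ∘ (mon_map ⊠ mon_map);
  mon_one : mon_map ∘ one A = one B }.

Record comonoid (V : monoidal) := Comonoid {
  com_ob :> V;
  comul : com_ob ~> com_ob ⊗ com_ob;
  counit : com_ob ~> unit_ob;
  comulA : assoc com_ob com_ob com_ob ∘ (comul ⊠ idm) ∘ comul
    = (idm ⊠ comul) ∘ comul;
  comul1l : lunit com_ob ∘ (counit ⊠ idm) ∘ comul = idm;
  comul1r : runit com_ob ∘ (idm ⊠ counit) ∘ comul = idm }.
Arguments comul {V} _.
Arguments counit {V} _.

Record com_hom (V : monoidal) (C D : comonoid V) := ComHom {
  com_map :> C ~> D;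
  com_comul : comul D ∘ com_map = (com_map ⊠ com_map) ∘ comul C;
  com_counit : counit D ∘ com_map = counit C }.

Record module (V : monoidal) (A : monoid V) := MkModule {
  mod_ob :> V;
  act : mod_ob ⊗ A ~> mod_ob;
  actA : act ∘ (act ⊠ idm) = act ∘ (idm ⊠ mul A) ∘ assoc mod_ob A A;
  act1 : act ∘ (idm ⊠ one A) = runit mod_ob }.
Arguments act {V A} _.

Record mod_hom (V : monoidal) (A : monoid V) (M N : module A) := ModHom {
  mod_map :> M ~> N;
  mod_act : mod_map ∘ act M = act N ∘ (mod_map ⊠ id_ A) }.

Record comodule (V : monoidal) (C : comonoid V) := Comodule {
  cmd_ob :> V;
  coact : cmd_ob ~> cmd_ob ⊗ C;
  coactA : assoc cmd_ob C C ∘ (coact ⊠ idm) ∘ coact = (idm ⊠ comul C) ∘ coact;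
  coact1 : runit cmd_ob ∘ (idm ⊠ counit C) ∘ coact = idm }.
Arguments coact {V C} _.

Record cmd_hom (V : monoidal) (C : comonoid V) (X Y : comodule C) := CmdHom {
  cmd_map :> X ~> Y;
  cmd_coact : coact Y ∘ cmd_map = (cmd_map ⊠ id_ C) ∘ coact X }.

(* The global categories: objects M_A, N_B (resp. X_C, Y_D) over varying
   monoids (resp. comonoids). *)
Record gmodule (V : monoidal) := GModule {
  gm_mon : monoid V;
  gm_mod :> module gm_mon }.

Record gmod_hom (V : monoidal) (M N : gmodule V) := GModHom {
  gm_base : mon_hom (gm_mon M) (gm_mon N);
  gm_map :> M ~> N;
  gm_act : gm_map ∘ act M = act N ∘ (gm_map ⊠ gm_base) }.

Record gcomodule (V : monoidal) := GComodule {
  gc_com : comonoid V;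
  gc_cmd :> comodule gc_com }.

Record gcmd_hom (V : monoidal) (X Y : gcomodule V) := GCmdHom {
  gc_base : com_hom (gc_com X) (gc_com Y);
  gc_map :> X ~> Y;
  gc_coact : coact Y ∘ gc_map = (gc_map ⊠ gc_base) ∘ coact X }.

Section HomEq.
Variable V : monoidal.

Lemma mon_hom_eq (A B : monoid V) (f g : mon_hom A B) :
  mon_map f = mon_map g -> f = g.
Proof.
case: f g => [f f1 f2] [g g1 g2] /= E; case: _ / E g1 g2 => g1 g2.
by rewrite (proof_irrelevance _ f1 g1) (proof_irrelevance _ f2 g2).
Qed.

Lemma com_hom_eq (C D : comonoid V) (f g : com_hom C D) :
  com_map f = com_map g -> f = g.
Proof.
case: f g => [f f1 f2] [g g1 g2] /= E; case: _ / E g1 g2 => g1 g2.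
by rewrite (proof_irrelevance _ f1 g1) (proof_irrelevance _ f2 g2).
Qed.

Lemma mod_hom_eq (A : monoid V) (M N : module A) (f g : mod_hom M N) :
  mod_map f = mod_map g -> f = g.
Proof.
case: f g => [f f1] [g g1] /= E; case: _ / E g1 => g1.
by rewrite (proof_irrelevance _ f1 g1).
Qed.

Lemma cmd_hom_eq (C : comonoid V) (X Y : comodule C) (f g : cmd_hom X Y) :
  cmd_map f = cmd_map g -> f = g.
Proof.
case: f g => [f f1] [g g1] /= E; case: _ / E g1 => g1.
by rewrite (proof_irrelevance _ f1 g1).
Qed.

Lemma gmod_hom_eq (M N : gmodule V) (f g : gmod_hom M N) :
  gm_base f = gm_base g -> gm_map f = gm_map g -> f = g.
Proof.
case: f g => [b f f1] [c g g1] /= Eb E; case: _ / Eb g1.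
case: _ / E => g1; by rewrite (proof_irrelevance _ f1 g1).
Qed.

Lemma gcmd_hom_eq (X Y : gcomodule V) (f g : gcmd_hom X Y) :
  gc_base f = gc_base g -> gc_map f = gc_map g -> f = g.
Proof.
case: f g => [b f f1] [c g g1] /= Eb E; case: _ / Eb g1.
case: _ / E => g1; by rewrite (proof_irrelevance _ f1 g1).
Qed.
End HomEq.

Section Categories.
Variable V : monoidal.

Program Definition mon_id (A : monoid V) : mon_hom A A := @MonHom V A A idm _ _.
Next Obligation. by rewrite tensm1 comp1f compf1. Qed.
Next Obligation. by rewrite comp1f. Qed.

Program Definition mon_comp (A B D : monoid V) (g : mon_hom B D)
  (f : mon_hom A B) : mon_hom A D := @MonHom V A D (g ∘ f) _ _.
Next Obligation. by rewrite -compA mon_mul compA mon_mul -compA -tensmM. Qed.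
Next Obligation. by rewrite -compA !mon_one. Qed.

Program Definition Mon : category :=
  @Category (monoid V) (@mon_hom V) mon_id mon_comp _ _ _.
Next Obligation. by apply: mon_hom_eq; apply: comp1f. Qed.
Next Obligation. by apply: mon_hom_eq; apply: compf1. Qed.
Next Obligation. by apply: mon_hom_eq; apply: compA. Qed.

Program Definition com_id (C : comonoid V) : com_hom C C :=
  @ComHom V C C idm _ _.
Next Obligation. by rewrite tensm1 comp1f compf1. Qed.
Next Obligation. by rewrite compf1. Qed.

Program Definition com_comp (C D E : comonoid V) (g : com_hom D E)
  (f : com_hom C D) : com_hom C E := @ComHom V C E (g ∘ f) _ _.
Next Obligation. by rewrite compA com_comul -compA com_comul compA -tensmM. Qed.
Next Obligation. by rewrite compA !com_counit. Qed.

Program Definition Comon : category :=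
  @Category (comonoid V) (@com_hom V) com_id com_comp _ _ _.
Next Obligation. by apply: com_hom_eq; apply: comp1f. Qed.
Next Obligation. by apply: com_hom_eq; apply: compf1. Qed.
Next Obligation. by apply: com_hom_eq; apply: compA. Qed.

Program Definition mod_id (A : monoid V) (M : module A) : mod_hom M M :=
  @ModHom V A M M idm _.
Next Obligation. by rewrite tensm1 comp1f compf1. Qed.

Program Definition mod_comp (A : monoid V) (L M N : module A)
  (g : mod_hom M N) (f : mod_hom L M) : mod_hom L N :=
  @ModHom V A L N (g ∘ f) _.
Next Obligation. by rewrite -compA mod_act compA mod_act -compA -tensmMl. Qed.

Program Definition Mod_over (A : monoid V) : category :=
  @Category (module A) (@mod_hom V A) (@mod_id A) (@mod_comp A) _ _ _.
Next Obligation. by apply: mod_hom_eq; apply: comp1f. Qed.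
Next Obligation. by apply: mod_hom_eq; apply: compf1. Qed.
Next Obligation. by apply: mod_hom_eq; apply: compA. Qed.

Program Definition cmd_id (C : comonoid V) (X : comodule C) : cmd_hom X X :=
  @CmdHom V C X X idm _.
Next Obligation. by rewrite tensm1 comp1f compf1. Qed.

Program Definition cmd_comp (C : comonoid V) (X Y Z : comodule C)
  (g : cmd_hom Y Z) (f : cmd_hom X Y) : cmd_hom X Z :=
  @CmdHom V C X Z (g ∘ f) _.
Next Obligation. by rewrite compA cmd_coact -compA cmd_coact compA tensmMl. Qed.

Program Definition Comod_over (C : comonoid V) : category :=
  @Category (comodule C) (@cmd_hom V C) (@cmd_id C) (@cmd_comp C) _ _ _.
Next Obligation. by apply: cmd_hom_eq; apply: comp1f. Qed.
Next Obligation. by apply: cmd_hom_eq; apply: compf1. Qed.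
Next Obligation. by apply: cmd_hom_eq; apply: compA. Qed.

Program Definition gmod_id (M : gmodule V) : gmod_hom M M :=
  @GModHom V M M (mon_id _) idm _.
Next Obligation. by rewrite tensm1 comp1f compf1. Qed.

Program Definition gmod_comp (L M N : gmodule V) (g : gmod_hom M N)
  (f : gmod_hom L M) : gmod_hom L N :=
  @GModHom V L N (mon_comp (gm_base g) (gm_base f)) (g ∘ f) _.
Next Obligation. by rewrite -compA gm_act compA gm_act -compA -tensmM. Qed.

Program Definition Mod : category :=
  @Category (gmodule V) (@gmod_hom V) gmod_id gmod_comp _ _ _.
Next Obligation.
by apply: gmod_hom_eq; [apply: mon_hom_eq|]; apply: comp1f.
Qed.
Next Obligation.
by apply: gmod_hom_eq; [apply: mon_hom_eq|]; apply: compf1.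
Qed.
Next Obligation.
by apply: gmod_hom_eq; [apply: mon_hom_eq|]; apply: compA.
Qed.

Program Definition gcmd_id (X : gcomodule V) : gcmd_hom X X :=
  @GCmdHom V X X (com_id _) idm _.
Next Obligation. by rewrite tensm1 comp1f compf1. Qed.

Program Definition gcmd_comp (X Y Z : gcomodule V) (g : gcmd_hom Y Z)
  (f : gcmd_hom X Y) : gcmd_hom X Z :=
  @GCmdHom V X Z (com_comp (gc_base g) (gc_base f)) (g ∘ f) _.
Next Obligation. by rewrite compA gc_coact -compA gc_coact compA -tensmM. Qed.

Program Definition Comod : category :=
  @Category (gcomodule V) (@gcmd_hom V) gcmd_id gcmd_comp _ _ _.
Next Obligation.
by apply: gcmd_hom_eq; [apply: com_hom_eq|]; apply: comp1f.
Qed.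
Next Obligation.
by apply: gcmd_hom_eq; [apply: com_hom_eq|]; apply: compf1.
Qed.
Next Obligation.
by apply: gcmd_hom_eq; [apply: com_hom_eq|]; apply: compA.
Qed.
End Categories.

Definition op (C : category) : category :=
  @Category C (fun X Y => Y ~> X) (fun X => id_ X)
    (fun X Y Z g f => f ∘ g)
    (fun X Y f => compf1 f) (fun X Y f => comp1f f)
    (fun W X Y Z h g f => esym (compA f g h)).

Record functor (C D : category) := Functor {
  fob :> C -> D;
  fmap : forall X Y : C, X ~> Y -> fob X ~> fob Y;
  fmap1 : forall X : C, fmap (id_ X) = idm;
  fmapM : forall (X Y Z : C) (g : Y ~> Z) (f : X ~> Y),
    fmap (g ∘ f) = fmap g ∘ fmap f }.
Arguments fmap {C D} _ {X Y} _.

Program Definition functor_comp (C D E : category) (G : functor D E)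
    (F : functor C D) : functor C E :=
  @Functor C E (fun X => G (F X)) (fun X Y f => fmap G (fmap F f)) _ _.
Next Obligation. by rewrite !fmap1. Qed.
Next Obligation. by rewrite !fmapM. Qed.

Record presheaf (C : category) := Presheaf {
  psh_ob :> C -> Type;
  psh_map : forall X Y : C, X ~> Y -> psh_ob Y -> psh_ob X;
  psh_map1 : forall (X : C) (x : psh_ob X), psh_map (id_ X) x = x;
  psh_mapM : forall (X Y Z : C) (g : Y ~> Z) (f : X ~> Y) (z : psh_ob Z),
    psh_map (g ∘ f) z = psh_map f (psh_map g z) }.
Arguments psh_map {C} _ {X Y} _ _.

(* Natural bijection C(-, R) ≅ F. *)
Record representation (C : category) (F : presheaf C) (R : C) := Representation {
  rep_map : forall X : C, (X ~> R) -> F X;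
  rep_inv : forall X : C, F X -> (X ~> R);
  rep_mapK : forall X : C, cancel (@rep_map X) (@rep_inv X);
  rep_invK : forall X : C, cancel (@rep_inv X) (@rep_map X);
  rep_nat : forall (X Y : C) (g : X ~> Y) (h : Y ~> R),
    rep_map (h ∘ g) = psh_map F g (rep_map h) }.
Arguments rep_map {C F R} _ {X} _.
Arguments rep_inv {C F R} _ {X} _.

(* D(d, G -) for contravariant G *)
Program Definition hom_from (C D : category) (d : D) (G : functor (op C) D) :
    presheaf C :=
  @Presheaf C (fun X => d ~> G X)
    (fun X Y g x => @fmap (op C) D G Y X g ∘ x) _ _.
Next Obligation. by rewrite (fmap1 G) comp1f. Qed.
Next Obligation. by rewrite compA; congr (_ ∘ _); apply: (fmapM G). Qed.

(* D(F -, d) for covariant F *)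
Program Definition hom_to (C D : category) (F : functor C D) (d : D) :
    presheaf C :=
  @Presheaf C (fun X => F X ~> d) (fun X Y g x => x ∘ fmap F g) _ _.
Next Obligation. by rewrite fmap1 compf1. Qed.
Next Obligation. by rewrite fmapM compA. Qed.

Definition is_equalizer (C : category) (X Y E : C) (f g : X ~> Y) (e : E ~> X) :=
  f ∘ e = g ∘ e /\
  forall (Z : C) (h : Z ~> X), f ∘ h = g ∘ h -> exists! k : Z ~> E, e ∘ k = h.

Definition has_coreflexive_equalizers (C : category) :=
  forall (X Y : C) (f g : X ~> Y) (r : Y ~> X),
    r ∘ f = idm -> r ∘ g = idm ->
    exists (E : C) (e : E ~> X), is_equalizer f g e.

Section Measuring.
Variable V : braided_closed.

Program Definition conv_monoid (C : comonoid V) (B : monoid V) : monoid V :=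
  @Monoid V (ihom C B) (conv_act (comul C) (mul B))
    (conv_unit (counit C) (one B)) _ _ _.
Next Obligation.
rewrite {1 2 3}conv_actE; apply: slide_actA; first exact: mulA.
by apply: conv_slideM; apply: comulA.
Qed.
Next Obligation.
by apply: conv_act_unitl; [apply: comul1l|apply: mul1l].
Qed.
Next Obligation.
rewrite conv_actE; apply: slide_act1; first exact: mul1r.
by apply: conv_slide1; apply: comul1r.
Qed.

Program Definition conv_module (C : comonoid V) (B : monoid V)
    (X : comodule C) (N : module B) : module (conv_monoid C B) :=
  @MkModule V (conv_monoid C B) (ihom X N) (conv_act (coact X) (act N)) _ _.
Next Obligation.
rewrite conv_actE; apply: slide_actA; first exact: actA.
by apply: conv_slideM; apply: coactA.
Qed.
Next Obligation.
rewrite conv_actE; apply: slide_act1; first exact: act1.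
by apply: conv_slide1; apply: coact1.
Qed.

Lemma ihom_map_comp X Y (N : V) Z (k : Z ~> ihom Y N) (h : X ~> Y) :
  ihom_map N h ∘ k = curry (ev Y N ∘ (k ⊠ h)).
Proof.
rewrite curry_comp; congr curry.
by rewrite (compE2 (tensm_rl _ _)).
Qed.

Program Definition conv_map (B : monoid V) (C D : comonoid V)
    (g : com_hom C D) : mon_hom (conv_monoid D B) (conv_monoid C B) :=
  @MonHom V (conv_monoid D B) (conv_monoid C B) (ihom_map B g) _ _.
Next Obligation.
rewrite !conv_actE; apply: esym; apply: slide_act_nat.
by apply: conv_slide_nat; apply: com_comul.
Qed.
Next Obligation.
rewrite ihom_map_comp -tensm_lr compA /conv_unit ev_curry; congr curry.
by rewrite (compE2 (lunit_nat _)) !compA (compE2 (com_counit g)).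
Qed.

(* [-, B] : Comon(V)^op → Mon(V) *)
Program Definition conv_functor (B : monoid V) :
    functor (op (Comon V)) (Mon V) :=
  @Functor (op (Comon V)) (Mon V) (fun C => conv_monoid C B)
    (fun D C g => conv_map B g) _ _.
Next Obligation. by apply: mon_hom_eq; apply: ihom_map1. Qed.
Next Obligation. by apply: mon_hom_eq; apply: ihom_mapM. Qed.

Definition conv_gmodule (N : gmodule V) (X : gcomodule V) : gmodule V :=
  GModule (conv_module X N).

Program Definition conv_gmap (N : gmodule V) (X Y : gcomodule V)
    (k : gcmd_hom X Y) : gmod_hom (conv_gmodule N Y) (conv_gmodule N X) :=
  @GModHom V (conv_gmodule N Y) (conv_gmodule N X)
    (conv_map (gm_mon N) (gc_base k)) (ihom_map N k) _.
Next Obligation.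
rewrite !conv_actE; apply: esym; apply: slide_act_nat.
by apply: conv_slide_nat; apply: gc_coact.
Qed.

(* [-, N] : Comod(V)^op → Mod(V) *)
Program Definition conv_gfunctor (N : gmodule V) :
    functor (op (Comod V)) (Mod V) :=
  @Functor (op (Comod V)) (Mod V) (conv_gmodule N)
    (fun Y X k => conv_gmap N k) _ _.
Next Obligation.
by apply: gmod_hom_eq; [apply: mon_hom_eq|]; apply: ihom_map1.
Qed.
Next Obligation.
by apply: gmod_hom_eq; [apply: mon_hom_eq|]; apply: ihom_mapM.
Qed.

Definition measurings (A B : monoid V) : presheaf (Comon V) :=
  hom_from (A : Mon V) (conv_functor B).

Definition module_measurings (M N : gmodule V) : presheaf (Comod V) :=
  hom_from (M : Mod V) (conv_gfunctor N).

(* P(A, B) *)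
Record univ_measuring_comonoid (A B : monoid V) := UnivMeasuringComonoid {
  umc_ob :> comonoid V;
  umc_rep : representation (measurings A B) umc_ob }.

(* Q(M, N): its underlying comonoid is P, and the representing bijection lies
   over that of P. *)
Record univ_measuring_comodule (A B : monoid V)
    (P : univ_measuring_comonoid A B) (M : module A) (N : module B) :=
  UnivMeasuringComodule {
    umq_ob :> comodule P;
    umq_rep : representation
      (module_measurings (GModule M) (GModule N)) (GComodule umq_ob);
    umq_over : forall (X : gcomodule V) (h : gcmd_hom X (GComodule umq_ob)),
      gm_base (rep_map umq_rep h) = rep_map (umc_rep P) (gc_base h) }.
End Measuring.

Section Coinvariants.
Variable V : monoidal.

Lemma lunitV_runitV_unit :
  iso_inv (lunit unit_ob) = iso_inv (runit unit_ob)
    :> ((unit_ob : V) ~> unit_ob ⊗ unit_ob).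
Proof.
apply: (iso_mono (i := lunit unit_ob)).
by rewrite iso_invK lunit_runit_unit iso_invK.
Qed.

Program Definition unit_comonoid : comonoid V :=
  @Comonoid V unit_ob (iso_inv (runit unit_ob)) idm _ _ _.
Next Obligation. by rewrite triangleV lunitV_runitV_unit. Qed.
Next Obligation. by rewrite tensm1 compf1 lunit_runit_unit iso_invK. Qed.
Next Obligation. by rewrite tensm1 compf1 iso_invK. Qed.

Program Definition trivial_comodule (Z : V) : comodule unit_comonoid :=
  @Comodule V unit_comonoid Z (iso_inv (runit Z)) _ _.
Next Obligation. by rewrite triangleV lunitV_runitV_unit. Qed.
Next Obligation. by rewrite tensm1 compf1 iso_invK. Qed.

(* V ≅ Comod_I *)
Program Definition trivial_comodule_functor :
    functor V (Comod_over unit_comonoid) :=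
  @Functor V (Comod_over unit_comonoid) trivial_comodule
    (fun Y Z k => @CmdHom V _ (trivial_comodule Y) (trivial_comodule Z) k _) _ _.
Next Obligation. by rewrite runitV_nat. Qed.
Next Obligation. by apply: cmd_hom_eq. Qed.
Next Obligation. by apply: cmd_hom_eq. Qed.

Program Definition corestrict (C D : comonoid V) (u : com_hom C D)
    (X : comodule C) : comodule D :=
  @Comodule V D X ((idm ⊠ u) ∘ coact X) _ _.
Next Obligation.
rewrite tensmMl !compA (compE2 (esym (tensm_swap (coact X) _))) !compA.
rewrite (compE2 (tensm_lr _ _)) assoc_nat -tensmMr com_comul tensmMr.
by rewrite -!compA; congr (_ ∘ _); rewrite !compA coactA.
Qed.
Next Obligation.
by rewrite !compA (compE2 (esym (tensmMr _ _ _))) com_counit coact1.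
Qed.

(* u_! *)
Program Definition corestrict_functor (C D : comonoid V) (u : com_hom C D) :
    functor (Comod_over C) (Comod_over D) :=
  @Functor (Comod_over C) (Comod_over D) (corestrict u)
    (fun X Y k => @CmdHom V _ (corestrict u X) (corestrict u Y) k _) _ _.

Next Obligation.
by rewrite -compA cmd_coact !compA tensm_swap.
Qed.
Next Obligation. by apply: cmd_hom_eq. Qed.
Next Obligation. by apply: cmd_hom_eq. Qed.

(* Comod_C(u_!(-), X) on V *)
Definition coinvariants_presheaf (C : comonoid V)
    (u : com_hom unit_comonoid C) (X : comodule C) : presheaf V :=
  hom_to (functor_comp (corestrict_functor u) trivial_comodule_functor)
    (X : Comod_over C).

(* E, with this structure, is the object of coinvariants u^*X. *)
Definition coinvariants (C : comonoid V)
    (u : com_hom unit_comonoid C) (X : comodule C) (E : V) :=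
  representation (coinvariants_presheaf u X) E.
(* f^*N *)
Program Definition restrict (A B : monoid V) (f : mon_hom A B)
    (N : module B) : module A :=
  @MkModule V A N (act N ∘ (idm ⊠ f)) _ _.
Next Obligation.
rewrite tensmMl !compA (compE2 (tensm_swap _ _)) !compA actA.
rewrite (compE2 (tensm_rl _ _)) (compE2 (assoc_nat _ _ _)) !compA.
by rewrite !(compE2 (esym (tensmMr _ _ _))) mon_mul.
Qed.
Next Obligation. by rewrite -compA -tensmMr mon_one act1. Qed.
End Coinvariants.

Section EnrichedHom.
Variable V : braided_closed.

Program Definition ihom_module (A : monoid V) (Z : V) (L : module A) :
    module A :=
  @MkModule V A (ihom Z L)
    (curry (act L ∘ (ev Z L ⊠ id_ A) ∘ iso_inv (assoc (ihom Z L) Z A)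
            ∘ (id_ (ihom Z L) ⊠ braid A Z) ∘ assoc (ihom Z L) A Z)) _ _.
Next Obligation.
apply: slide_actA; first exact: actA.
rewrite braid_nat -!compA; congr (_ ∘ _); rewrite !compA.
by rewrite -hexagon2' isoK.
Qed.
Next Obligation.
apply: slide_act1; first exact: act1.
by rewrite braid_nat -compA braid_lunitV.
Qed.

Lemma ihom_module_nat (A : monoid V) (Y Z : V) (L : module A) (k : Y ~> Z) :
  ihom_map L k ∘ act (ihom_module Z L)
    = act (ihom_module Y L) ∘ (ihom_map L k ⊠ id_ A).
Proof.
apply: esym; apply: slide_act_nat.
by rewrite tensm1 compf1 braid_nat.
Qed.

(* [-, L] : V^op → Mod_A *)
Program Definition ihom_module_functor (A : monoid V) (L : module A) :
    functor (op V) (Mod_over A) :=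
  @Functor (op V) (Mod_over A) (fun Z => ihom_module Z L)
    (fun Z Y k => @ModHom V A (ihom_module Z L) (ihom_module Y L)
                    (ihom_map L k) (ihom_module_nat L k)) _ _.
Next Obligation. by apply: mod_hom_eq; apply: ihom_map1. Qed.
Next Obligation. by apply: mod_hom_eq; apply: ihom_mapM. Qed.

(* H, with this structure, is the enriched hom of Mod_A from M to L. *)
Definition enriched_hom (A : monoid V) (M L : module A) (H : V) :=
  representation (hom_from (M : Mod_over A) (ihom_module_functor L)) H.

Lemma conv_slide_unit (B : V) :
  conv_slide B (iso_inv (runit unit_ob)) ∘ (curry (runit B) ⊠ idm)
    = braid B unit_ob.
Proof.
rewrite conv_slideE (compE2 (tensm_swap _ _)) !compA.
rewrite (compE2 (slide_natl _ _ _)) !compA -tensmMr ev_curry slideE !compA.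
rewrite runit_tens runit_nat (compE2 (iso_swap (esym (runit_tens _ _)))).
by rewrite -compA -tensmMr iso_invK tensm1 compf1.
Qed.

Program Definition to_conv_unit (B : monoid V) :
    mon_hom B (conv_monoid (unit_comonoid V) B) :=
  @MonHom V B (conv_monoid (unit_comonoid V) B) (curry (runit B)) _ _.
Next Obligation.
apply: curry_inj; rewrite !tensmMl !compA ev_curry ev_conv_act /=.
rewrite (compE2 (assoc_nat _ _ _)) !compA.
rewrite -(tensm_lr _ (curry _ ⊠ _)) !compA (compE2 (tensm_swap _ _)) !compA.
rewrite (compE2 (assocV_natl _ _ _)) !compA.
rewrite (compE2 (esym (tensmMl _ _ _))) ev_curry.
rewrite (compE2 (esym (tensmMr _ _ _))) conv_slide_unit.
rewrite (compE2 (iso_swap (esym (triangle _ _)))).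
rewrite (compE2 (esym (tensmMr _ _ _))) -braid_runit (compE2 (runit_tens _ _)).
by rewrite runit_nat.
Qed.
Next Obligation.
apply: curry_inj; rewrite tensmMl compA !ev_curry /= compf1.
by rewrite runit_nat lunit_runit_unit.
Qed.

Lemma mon_inv_hom (A B : monoid V) (f : mon_hom A B) (g : B ~> A) :
  g ∘ f = idm -> f ∘ g = idm ->
  g ∘ mul B = mul A ∘ (g ⊠ g) /\ g ∘ one B = one A.
Proof.
move=> gf fg; split; last by rewrite -(mon_one f) compA gf comp1f.
rewrite -[LHS]compf1 -tensm1 -fg tensmM -!compA (compA _ (f ⊠ f)) -mon_mul.
by rewrite !compA gf comp1f.
Qed.

Lemma to_conv_unitK (B : monoid V) :
  (ev unit_ob B ∘ iso_inv (runit (ihom unit_ob B))) ∘ to_conv_unit B = idm.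
Proof. by rewrite -compA runitV_nat compA ev_curry iso_invK. Qed.

Lemma from_conv_unitK (B : monoid V) :
  to_conv_unit B ∘ (ev unit_ob B ∘ iso_inv (runit (ihom unit_ob B))) = idm.
Proof.
apply: curry_inj; rewrite tensmMl compA ev_curry runit_nat isoK.
by rewrite tensm1 compf1.
Qed.

Definition from_conv_unit (B : monoid V) :
    mon_hom (conv_monoid (unit_comonoid V) B) B :=
  let h := @mon_inv_hom B (conv_monoid (unit_comonoid V) B) (to_conv_unit B) _
             (to_conv_unitK B) (from_conv_unitK B) in
  MonHom (proj1 h) (proj2 h).

(* B ≅ [I, B] *)
Program Definition conv_unit_iso (B : monoid V) :
    @iso (Mon V) B (conv_monoid (unit_comonoid V) B) :=
  @Iso (Mon V) _ _ (to_conv_unit B) (from_conv_unit B) _ _.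
Next Obligation. by apply: mon_hom_eq; apply: to_conv_unitK. Qed.
Next Obligation. by apply: mon_hom_eq; apply: from_conv_unitK. Qed.

(* The comonoid morphism I → P corresponding to A → B ≅ [I, B]. *)
Definition point_of (A B : monoid V) (P : univ_measuring_comonoid A B)
    (f : mon_hom A B) : com_hom (unit_comonoid V) P :=
  rep_inv (umc_rep P) (@comp (Mon V) _ _ _ (conv_unit_iso B) f).
End EnrichedHom.

(* Main.v *)
From mathcomp Require Import ssreflect ssrfun.
From Stdlib Require Import IndefiniteDescription.
Require Import Defs.

Set Implicit Arguments.
Unset Strict Implicit.
Unset Printing Implicit Defensive.

Local Open Scope cat_scope.

(** For an object Z of V, a comodule map from the corestriction of the trivial
    comodule Z along the point of P corresponding to f into Q is the same as a
    map of the global category of comodules from Z over I to Q over P whose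
    comonoid component is that point. The universal property of Q turns such a
    map into a map from M to [Z, N] in the global category of modules; since
    the bijection for Q lies over the one for P, the comonoid component is the
    point of f exactly when the monoid component is A -> B -> [I, B]. A map of
    the latter kind is an A-linear map from M to [Z, N] with the [I, B]-action
    restricted along A -> B -> [I, B], and this restricted action is the one
    induced by the A-module f^*N ([conv_act_point]): convolution against the
    trivial comodule Z reduces to the braiding of B with Z.

    So the presheaf represented by the coinvariants and the presheaf represented
    by the enriched hom are isomorphic ([coinvariants_measurings]). An equalizer
    of the coaction of Q and of the map Q -> Q ⊗ P given by the point of f
    represents the first one, and exists because the counit provides a common
    retraction ([coinvariants_exist]). Hence both representing objects exist,
    and any two are isomorphic by the Yoneda lemma ([representation_unique]). *)

Record presheaf_iso (C : category) (F G : presheaf C) := PresheafIso {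
  psi_map : forall X : C, F X -> G X;
  psi_inv : forall X : C, G X -> F X;
  psi_mapK : forall X : C, cancel (@psi_map X) (@psi_inv X);
  psi_invK : forall X : C, cancel (@psi_inv X) (@psi_map X);
  psi_nat : forall (X Y : C) (g : X ~> Y) (y : F Y),
    psi_map (psh_map F g y) = psh_map G g (psi_map y) }.

Definition representation_transport (C : category) (F G : presheaf C) (R : C)
    (i : presheaf_iso F G) (r : representation F R) : representation G R.
Proof.
exists (fun X h => psi_map i (rep_map r h))
  (fun X y => rep_inv r (psi_inv i y)).
- by move=> X h; rewrite psi_mapK rep_mapK.
- by move=> X y; rewrite rep_invK psi_invK.
- by move=> X Y g h; rewrite rep_nat psi_nat.
Defined.

Lemma rep_map_inj (C : category) (F : presheaf C) (R : C)
    (r : representation F R) (X : C) (g h : X ~> R) :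
  rep_map r g = rep_map r h -> g = h.
Proof. exact: (can_inj (@rep_mapK _ _ _ r X)). Qed.

(** The Yoneda argument: either map sends the universal element of its target to
    that of its source, and a map into a representing object is determined by
    the element it names. *)
Definition representation_unique (C : category) (F : presheaf C) (R S : C)
    (r : representation F R) (s : representation F S) : iso R S.
Proof.
exists (rep_inv s (rep_map r idm)) (rep_inv r (rep_map s idm)).
- apply: (rep_map_inj (r := r)).
  by rewrite rep_nat rep_invK -rep_nat comp1f rep_invK.
- apply: (rep_map_inj (r := s)).
  by rewrite rep_nat rep_invK -rep_nat comp1f rep_invK.
Defined.

Section Coinvariants.
Variables (V : monoidal) (C : comonoid V) (u : com_hom (unit_comonoid V) C).
Variable X : comodule C.

Definition point_coaction : X ~> X ⊗ C := (idm ⊠ u) ∘ iso_inv (runit X).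

(** By naturality of the right unitor, inserting the point after k is the same
    as inserting it before k. *)
Lemma comodule_map_equalizes (Z : V) (k : Z ~> X) :
  coact X ∘ k = point_coaction ∘ k <->
  coact X ∘ k = (k ⊠ idm) ∘ coact (corestrict u (trivial_comodule Z)).
Proof.
suff -> : point_coaction ∘ k
        = (k ⊠ idm) ∘ coact (corestrict u (trivial_comodule Z)) by [].
rewrite /point_coaction (compE2 (runitV_nat _)) !compA.
by rewrite (tensm_swap k).
Qed.

(** The coaction and the coaction by the point are both split by the counit of
    C, so the pair is coreflexive; its equalizer represents the comodule maps
    out of trivial comodules by [comodule_map_equalizes]. *)
Lemma coinvariants_exist (hV : has_coreflexive_equalizers V) :
  exists E : V, inhabited (coinvariants u X E).
Proof.
have r1 : runit X ∘ (idm ⊠ counit C) ∘ coact X = idm by apply: coact1.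
have r2 : runit X ∘ (idm ⊠ counit C) ∘ point_coaction = idm.
  rewrite /point_coaction !compA (compE2 (esym (tensmMr _ _ _))) com_counit /=.
  by rewrite tensm1 compf1 iso_invK.
have [E [e [ee eU]]] := hV _ _ _ _ _ r1 r2.
exists E; constructor.
have fwdP Z (h : Z ~> E) : coact X ∘ (e ∘ h)
    = ((e ∘ h) ⊠ idm) ∘ coact (corestrict u (trivial_comodule Z)).
  by apply/comodule_map_equalizes; rewrite !compA ee.
(* A representation carries its inverse as data, so the unique factorization
   through e has to be chosen. *)
have lift Z (k : cmd_hom (corestrict u (trivial_comodule Z)) X) :
    {h : Z ~> E | e ∘ h = k & forall h', e ∘ h' = k -> h = h'}.
  have /constructive_indefinite_description [h [hk hU]] :
      exists! h : Z ~> E, e ∘ h = k.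
    by apply: eU; apply/comodule_map_equalizes; exact: (cmd_coact k).
  by exists h.
pose fwd Z h := @CmdHom V C (corestrict u (trivial_comodule Z)) X _ (fwdP Z h).
exists fwd (fun Z k => s2val (lift Z k)).
- by move=> Z h; case: (lift Z _) => h' /= _; apply.
- by move=> Z k; apply: cmd_hom_eq; case: (lift Z k).
- by move=> Y Z g h; apply: cmd_hom_eq; apply: compA.
Qed.
End Coinvariants.

(** For the trivial comodule Z, the convolution action on [Z, N] evaluates
    [I, B] at the unit, which leaves only the braiding of B past Z. *)
Lemma conv_slide_trivial (V : braided_closed) (B Z : V) :
  conv_slide B (iso_inv (runit Z)) ∘ (curry (runit B) ⊠ idm) = braid B Z.
Proof.
rewrite conv_slideE (compE2 (tensm_swap _ _)) !compA.
rewrite (compE2 (slide_natl _ _ _)) !compA -tensmMr ev_curry slideE !compA.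
rewrite runit_tens runit_nat (compE2 (iso_swap (esym (runit_tens _ _)))).
by rewrite -compA -tensmMr iso_invK tensm1 compf1.
Qed.

(** Restricting scalars in the target of [X, N] amounts to composing the
    exchange map s with the monoid map, which presents both module structures
    of [conv_act_point] over the same action on N. *)
Lemma slide_act_restrict (V : braided_closed) (K X N B D : V)
    (s : K ⊗ X ~> X ⊗ B) (g : B ~> D) (mu : N ⊗ D ~> N) :
  slide_act s (mu ∘ (idm ⊠ g)) = slide_act ((idm ⊠ g) ∘ s) mu.
Proof.
rewrite /slide_act; congr curry; rewrite tensmMr !compA.
rewrite (compE2 (assocV_natr _ _ _)) !compA.
by rewrite (compE2 (tensm_swap _ _)) !compA.
Qed.

Section Comparison.
Variables (V : braided_closed) (A B : monoid V) (f : mon_hom A B).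
Variable N : module B.

Definition point_map : mon_hom A (conv_monoid (unit_comonoid V) B) :=
  @comp (Mon V) _ _ _ (conv_unit_iso B) f.

(** The A-module structure on [Z, N] induced by f^*N is the [I, B]-module
    structure restricted along A -> B -> [I, B]. *)
Lemma conv_act_point (Z : V) :
  act (conv_module (trivial_comodule Z) N) ∘ (idm ⊠ point_map)
    = act (ihom_module Z (restrict f N)).
Proof.
(* slide_act_nat is used with the identity of Z as the map between objects. *)
change (conv_act (iso_inv (runit Z)) (act N) ∘ (idm ⊠ (curry (runit B) ∘ f))
  = slide_act (braid A Z) (act N ∘ (idm ⊠ f))).
rewrite conv_actE slide_act_restrict -(comp1f (slide_act (_ ∘ _) _)).
rewrite -(ihom_map1 Z N); apply: slide_act_nat.
rewrite !tensm1 comp1f compf1 tensmMl compA conv_slide_trivial.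
by rewrite braid_nat.
Qed.

Variables (P : univ_measuring_comonoid A B) (M : module A).
Variable Q : univ_measuring_comodule P M N.
Notation u := (point_of P f).
Notation triv Z := (GComodule (trivial_comodule Z)).
Notation gQ := (GComodule Q).
Notation gM := (GModule M).
Notation gN := (GModule N).

Definition comodule_map_over (Z : V)
    (k : cmd_hom (corestrict u (trivial_comodule Z)) Q) :
    gcmd_hom (triv Z) gQ.
Proof.
exists u (k : Z ~> Q).
by rewrite [LHS](cmd_coact k) /= compA tensm_lr.
Defined.

Definition linear_map_over (Z : V)
    (p : mod_hom M (ihom_module Z (restrict f N))) :
    gmod_hom gM (conv_gmodule gN (triv Z)).
Proof.
exists point_map (p : M ~> ihom Z N).
by rewrite [LHS](mod_act p) -conv_act_point -compA tensm_rl.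
Defined.

Definition trivial_gmap (Y Z : V) (g : Y ~> Z) : gcmd_hom (triv Y) (triv Z).
Proof.
exists (com_id _ : com_hom (gc_com (triv Y)) (gc_com (triv Z))) g.
exact: runitV_nat.
Defined.

Lemma comodule_map_of_over (Z : V) (h : gcmd_hom (triv Z) gQ) :
  gc_base h = u ->
  coact Q ∘ h = (gc_map h ⊠ idm) ∘ coact (corestrict u (trivial_comodule Z)).
Proof. by move=> <-; rewrite [LHS](gc_coact h) /= compA tensm_lr. Qed.

Lemma linear_map_of_over (Z : V) (q : gmod_hom gM (conv_gmodule gN (triv Z))) :
  gm_base q = point_map ->
  gm_map q ∘ act M = act (ihom_module Z (restrict f N)) ∘ (gm_map q ⊠ idm).
Proof.
by move=> qE; rewrite [LHS](gm_act q) qE -conv_act_point -compA tensm_rl.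
Qed.

(** This lemma and the next are where the bijection for Q lying over the one
    for P is used: fixing the comonoid component to be the point of f fixes the
    monoid component, and conversely. *)
Lemma measuring_base (Z : V)
    (k : cmd_hom (corestrict u (trivial_comodule Z)) Q) :
  gm_base (rep_map (umq_rep Q) (comodule_map_over k)) = point_map.
Proof.
rewrite umq_over.
exact: (@rep_invK _ _ _ (umc_rep P) (unit_comonoid V) point_map).
Qed.

Lemma comodule_base (Z : V) (p : mod_hom M (ihom_module Z (restrict f N))) :
  gc_base (rep_inv (umq_rep Q)
    (linear_map_over p : module_measurings gM gN (triv Z))) = u.
Proof.
apply: (rep_map_inj (r := umc_rep P)).
by rewrite -umq_over rep_invK /point_of rep_invK.
Qed.

(** The universal property of Q restricted to maps over the point of f; each
    round trip reduces to that of Q because a map of a global category is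
    determined by its two components. *)
Definition coinvariants_measurings :
  presheaf_iso (coinvariants_presheaf u Q)
    (hom_from (M : Mod_over A) (ihom_module_functor (restrict f N))).
Proof.
pose fwd Z k := @ModHom V A M (ihom_module Z (restrict f N)) _
  (linear_map_of_over (@measuring_base Z k)).
pose bwd Z p := @CmdHom V P (corestrict u (trivial_comodule Z)) Q _
  (comodule_map_of_over (@comodule_base Z p)).
exists fwd bwd.
- move=> Z k; apply: cmd_hom_eq => /=.
  set p := fwd Z k.
  suff -> : linear_map_over p = rep_map (umq_rep Q) (comodule_map_over k).
    by rewrite rep_mapK.
  by apply: gmod_hom_eq; rewrite ?measuring_base.
- move=> Z p; apply: mod_hom_eq => /=.
  set k := bwd Z p.
  suff -> : comodule_map_over k
      = rep_inv (umq_rep Q)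
          (linear_map_over p : module_measurings gM gN (triv Z)).
    by rewrite rep_invK.
  by apply: gcmd_hom_eq; rewrite ?comodule_base.
- move=> Y Z g k; apply: mod_hom_eq => /=.
  suff -> : comodule_map_over (psh_map (coinvariants_presheaf u Q) g k)
      = @comp (Comod V) _ _ _ (comodule_map_over k) (trivial_gmap g)
    by rewrite rep_nat.
  by apply: gcmd_hom_eq => //; apply: com_hom_eq; rewrite /= compf1.
Defined.
End Comparison.

Theorem proposition7p1 (V : braided_closed)
    (hV : has_coreflexive_equalizers V)
    (A B : monoid V) (P : univ_measuring_comonoid A B) (f : mon_hom A B)
    (M : module A) (N : module B) (Q : univ_measuring_comodule P M N) :
  (exists E : V, inhabited (coinvariants (point_of P f) Q E)) /\
  (exists H : V, inhabited (enriched_hom M (restrict f N) H)) /\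
  (forall E H : V,
     coinvariants (point_of P f) Q E ->
     enriched_hom M (restrict f N) H ->
     inhabited (iso E H)).
Proof.
have i := coinvariants_measurings f Q.
have [E [e]] := coinvariants_exist (point_of P f) Q hV.
split; first by exists E.
split; first by exists E; constructor; apply: representation_transport i e.
move=> E' H e' h; constructor.
exact: representation_unique (representation_transport i e') h.
Qed.
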